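(* Let $n\ge d\ge1$ and consider the case $m=k=1$ (so $s=1$ and the sketching matrix is an arbitrary row vector $w^T$, $w\in\mathbb R^n$). Let $\mathcal L_1=\{A\mapsto L_1^{\mathrm{SCW}}(w^T,A)\}_{w\in\mathbb R^n}$ as functions on $\mathcal A=\{A\in\mathbb R^{n\times d}:\|A\|_F=1\}$. Then $\mathrm{pdim}(\mathcal L_1)=\Theta(n)$, and for every $\epsilon\in(0,1/2)$, $\mathrm{fatdim}_\epsilon(\mathcal L_1)=\Theta(n)$ (with absolute constants in $\Theta$).
   Context: For a matrix $M$, $[M]_k$ denotes a best approximation of $M$ of rank at most $k$ in Frobenius norm. For $S\in\mathbb R^{m\times n}$ and $A\in\mathbb R^{n\times d}$, SCW outputs $\mathrm{SCW}_k(S,A)$: if $SA=0$ the zero matrix; otherwise, with a thin SVD $SA=U\Sigma V^T$, the matrix $[AV]_kV^T$. The SCW loss is $L_k^{\mathrm{SCW}}(S,A)=\|A-\mathrm{SCW}_k(S,A)\|_F$. A set $\{x_1,\dots,x_N\}$ is pseudo-shattered by a class $\mathcal L$ of real functions if there are thresholds $r_i$ such that for every $I\subseteq\{1,\dots,N\}$ some $L\in\mathcal L$ has $L(x_i)>r_i\iff i\in I$; it is $\gamma$-fat shattered if there are thresholds $r_i$ such that for every $I$ some $L\in\mathcal L$ has $L(x_i)>r_i+\gamma$ for $i\in I$ and $L(x_i)<r_i-\gamma$ for $i\notin I$. $\mathrm{pdim}$ and $\mathrm{fatdim}_\gamma$ are the maximum sizes of such sets. *)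

(* Defs.v *)
From HB Require Import structures.
From mathcomp Require Import all_boot all_order all_algebra.
From mathcomp Require Import boolp classical_sets reals.
Set Implicit Arguments.
Unset Strict Implicit.
Unset Printing Implicit Defensive.
Import Order.TTheory GRing.Theory Num.Theory.
Local Open Scope ring_scope.

Section SCW.
Variable R : realType.

Definition frob (m n : nat) (M : 'M[R]_(m, n)) : R :=
  Num.sqrt (\sum_(i < m) \sum_(j < n) M i j ^+ 2).

Definition is_best_rank_approx (m n k : nat) (M B : 'M[R]_(m, n)) : Prop :=
  (\rank B <= k)%N /\
  forall C : 'M[R]_(m, n), (\rank C <= k)%N -> frob (M - B) <= frob (M - C).

Definition is_thin_svd (m d r : nat) (M : 'M[R]_(m, d))
    (U : 'M[R]_(m, r)) (s : 'rV[R]_r) (V : 'M[R]_(d, r)) : Prop :=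
  [/\ M = U *m diag_mx s *m V^T, U^T *m U = 1%:M, V^T *m V = 1%:M
    & forall i, 0 < s 0 i].

Definition is_SCW (k m n d : nat) (S : 'M[R]_(m, n)) (A : 'M[R]_(n, d))
    (M : 'M[R]_(n, d)) : Prop :=
  (S *m A = 0 /\ M = 0) \/
  (S *m A != 0 /\
   exists r (U : 'M[R]_(m, r)) (s : 'rV[R]_r) (V : 'M[R]_(d, r)),
     is_thin_svd (S *m A) U s V /\
     exists B : 'M[R]_(n, r), is_best_rank_approx k (A *m V) B /\ M = B *m V^T).

(* SCW loss  L_k^SCW(S, A) = || A - SCW_k(S, A) ||_F  (chosen value; the value
   does not depend on the choices of SVD and best approximation). *)
Definition SCW_loss (k m n d : nat) (S : 'M[R]_(m, n)) (A : 'M[R]_(n, d)) : R :=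
  xget 0 (fun l : R => exists M, is_SCW k S A M /\ l = frob (A - M)).

Definition L1_class (n d : nat) : set ('M[R]_(n, d) -> R) :=
  fun f => exists w : 'cV[R]_n, f = SCW_loss 1 w^T.

Definition unit_frob_sphere (n d : nat) : set 'M[R]_(n, d) :=
  fun A => frob A = 1.

Definition pseudo_shatters (X : Type) (D : set X) (F : set (X -> R))
    (N : nat) (x : 'I_N -> X) : Prop :=
  injective x /\ (forall i, D (x i)) /\
  exists r : 'I_N -> R, forall I : {set 'I_N},
    exists2 f, F f & forall i, (r i < f (x i)) = (i \in I).

Definition fat_shatters (X : Type) (D : set X) (F : set (X -> R)) (gamma : R)
    (N : nat) (x : 'I_N -> X) : Prop :=
  injective x /\ (forall i, D (x i)) /\
  exists r : 'I_N -> R, forall I : {set 'I_N},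
    exists2 f, F f & forall i,
      (i \in I -> r i + gamma < f (x i)) /\ (i \notin I -> f (x i) < r i - gamma).

End SCW.

(* Main.v *)
(* A shattered set yields [N] quadratic forms on [R^n] realizing all [2^N] strict
   sign patterns: [r < L(A)] says that either [A^T w = 0] or
   [(1 - r^2) |A^T w|^2 - |A A^T w|^2 > 0], and a small perturbation makes this a
   strict sign condition at the finitely many witnesses.  The bound [N = O(n)] for
   sign patterns is a Warren-type theorem, proved without Bezout, Sard or Morse
   theory.  Add the form [rho - |w|^2] to make all cells bounded.  In every cell,
   for integer [b] and positive integer [c], the product of the [|f_i| ^ c_i] and
   of [exp (- b . w)] has a maximum; with [y_i = c_i / f_i(w)] it solves
   [y_i f_i(w) = c_i] and [\sum_i y_i grad f_i(w) = b], equations of bidegree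
   (2,1) and (1,1) in [(w, y)].  Hence the polynomial map on the left has at least
   [2^N] points, one per cell, in the fiber over each grid point [(b, c)].
   Newton polynomials in this map, multiplied by Lagrange polynomials in [w], form
   a triangular, hence independent, family of size [2^N * #|grid|]; comparing with
   the dimension of the space of polynomials of the relevant bidegree, for a large
   simplicial grid, gives [2^N <= O(1 + N / n) ^ n].

   The lower bound uses the matrices with a single nonzero entry [1], in a fixed
   column, whose loss is [1] or [0] according to whether [w_i] vanishes. *)
Require Import Defs.
From HB Require Import structures.
From mathcomp Require Import all_boot all_order all_algebra.
From mathcomp Require Import boolp classical_sets reals.
From mathcomp Require Import functions.
From mathcomp Require Import topology normedtype sequences derive realfun exp.
From mathcomp Require Import zify ring lra.
Import Order.TTheory GRing.Theory Num.Theory.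
Local Open Scope ring_scope.
Import numFieldTopology.Exports numFieldNormedType.Exports.
Set Implicit Arguments.
Unset Strict Implicit.
Unset Printing Implicit Defensive.

(** * Polynomials of bounded bidegree and fibers over a grid *)

Lemma sum_leq_eq (I : finType) (a b : I -> nat) :
  (forall k, (a k <= b k)%N) -> (\sum_k b k <= \sum_k a k)%N -> a =1 b.
Proof.
move=> ab sba k; move: sba.
rewrite [X in (X <= _)%N -> _](bigD1 k) //= [X in (_ <= X)%N -> _](bigD1 k) //=.
have : (\sum_(i | i != k) a i <= \sum_(i | i != k) b i)%N by apply: leq_sum.
have := ab k; lia.
Qed.

Section Bidegree.
Variable R : fieldType.

(** A vanishing combination of the rows of the coefficient matrix gives a vanishing combination of
    the [phi i] at every point. Evaluated at [pt i], it retains only the term of [i] and terms of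
    smaller [wt], so strong induction on [wt] kills all coefficients. *)
Lemma triangular_card (I M : finType) (Pt : Type) (phi : I -> Pt -> R)
    (mon : M -> Pt -> R) (c : I -> M -> R) (pt : I -> Pt) (wt : I -> nat) :
  (forall i p, phi i p = \sum_m c i m * mon m p) ->
  (forall i, phi i (pt i) != 0) ->
  (forall i j, i != j -> (wt j <= wt i)%N -> phi i (pt j) = 0) ->
  (#|I| <= #|M|)%N.
Proof.
move=> phiE phi_diag phi_trig.
pose C := \matrix_(i < #|I|, m < #|M|) c (enum_val i) (enum_val m).
suff : row_free C by move=> /eqP <-; exact: rank_leq_col.
apply: inj_row_free => v vC0.
pose u i := v 0 (enum_rank i).
have u0 p : \sum_i u i * phi i p = 0.
  transitivity (\sum_m (\sum_i u i * c i m) * mon m p).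
    under eq_bigr do rewrite phiE big_distrr /=.
    rewrite exchange_big /=; apply: eq_bigr => m _.
    by rewrite big_distrl /=; apply: eq_bigr => i _; rewrite mulrA.
  rewrite big1 // => m _; have /rowP/(_ (enum_rank m)) := vC0.
  rewrite !mxE (reindex enum_rank) /=; last first.
    by exists enum_val => i _; rewrite ?enum_rankK ?enum_valK.
  under eq_bigr do rewrite mxE !enum_rankK.
  by rewrite /u => ->; rewrite mul0r.
suff u_eq0 i : u i = 0.
  by apply/rowP => k; rewrite mxE -(u_eq0 (enum_val k)) /u enum_valK.
have [k] := ubnP (wt i); elim: k i => // k IH i; rewrite ltnS => wtk.
have := u0 (pt i); rewrite (bigD1 i) //= big1 ?addr0 => [|j ji].
  by move/eqP; rewrite mulf_eq0 (negPf (phi_diag i)) orbF => /eqP.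
have [wij|wji] := leqP (wt i) (wt j); first by rewrite phi_trig ?mulr0.
by rewrite IH ?mul0r // (leq_trans wji).
Qed.

(** Monomials of total degree at most [D]; ordinal entries make this a finite type, counted by a
    binomial coefficient. *)
Definition expo (n D : nat) := {t : n.-tuple 'I_D.+1 | (\sum_(i <- t) i <= D)%N}.

Definition exponent n D (t : expo n D) (k : 'I_n) : nat := tnth (sval t) k.

Lemma card_expo n D : #|{: expo n D}| = 'C(n + D, n).
Proof.
rewrite card_sig -card_partial_ord_partitions.
by apply: eq_card => t; rewrite !inE.
Qed.

Lemma exponent_sum n D (t : expo n D) : (\sum_k exponent t k <= D)%N.
Proof. by have := svalP t; rewrite big_tuple. Qed.

Lemma exponent_inj n D (s t : expo n D) : exponent s =1 exponent t -> s = t.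
Proof. by move=> st; apply/val_inj/eq_from_tnth => k; apply/val_inj/st. Qed.

Lemma exponent_surj n D (a : 'I_n -> nat) :
  (\sum_k a k <= D)%N -> exists t : expo n D, exponent t =1 a.
Proof.
move=> aD; have ak k : (a k < D.+1)%N.
  by rewrite ltnS (leq_trans _ aD) // (bigD1 k) //= leq_addr.
pose t := [tuple Ordinal (ak k) | k < n].
have tD : (\sum_(i <- t) i <= D)%N.
  by rewrite big_tuple; under eq_bigr do rewrite tnth_mktuple.
by exists (exist _ t tD) => k; rewrite /exponent /= tnth_mktuple.
Qed.

Definition mono n (x : 'rV[R]_n) (a : 'I_n -> nat) := \prod_k x 0 k ^+ a k.

Lemma monoD n (x : 'rV[R]_n) (a b : 'I_n -> nat) :
  mono x (fun k => (a k + b k)%N) = mono x a * mono x b.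
Proof. by rewrite /mono -big_split; apply: eq_bigr => k _; rewrite exprD. Qed.

(** Polynomial functions are recorded by coefficients over a finite index type, the shape that
    [triangular_card] expects; [D] and [E] bound total degrees. *)
Definition bideg n q (D E : nat) (g : 'rV[R]_n -> 'rV[R]_q -> R) :=
  exists c : expo n D * expo q E -> R, forall x y,
    g x y = \sum_m c m * (mono x (exponent m.1) * mono y (exponent m.2)).

Section Closure.
Variables n q : nat.
Implicit Types (g h : 'rV[R]_n -> 'rV[R]_q -> R) (D E : nat).

Lemma bideg_ext D E g h : (forall x y, g x y = h x y) ->
  bideg D E g -> bideg D E h.
Proof. by move=> gh [c gE]; exists c => x y; rewrite -gh gE. Qed.

Lemma bideg_mono D E (a : 'I_n -> nat) (e : 'I_q -> nat) :
  (\sum_k a k <= D)%N -> (\sum_k e k <= E)%N ->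
  bideg D E (fun x y => mono x a * mono y e).
Proof.
move=> /exponent_surj [s sa] /exponent_surj [t te].
exists (fun m => (m == (s, t))%:R) => x y.
rewrite (bigD1 (s, t)) //= eqxx mul1r big1 ?addr0 => [|m /negPf ->];
  last by rewrite mul0r.
by congr (_ * _); apply: eq_bigr => k _; rewrite ?sa ?te.
Qed.

Lemma bidegD D E g h : bideg D E g -> bideg D E h ->
  bideg D E (fun x y => g x y + h x y).
Proof.
move=> [c gE] [d hE]; exists (fun m => c m + d m) => x y.
by rewrite gE hE -big_split; apply: eq_bigr => m _ /=; rewrite mulrDl.
Qed.

Lemma bidegZ D E (a : R) g : bideg D E g -> bideg D E (fun x y => a * g x y).
Proof.
move=> [c gE]; exists (fun m => a * c m) => x y.
by rewrite gE big_distrr; apply: eq_bigr => m _ /=; rewrite mulrA.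
Qed.

Lemma bideg_cst D E (a : R) : @bideg n q D E (fun _ _ => a).
Proof.
have := @bideg_mono D E (fun=> 0%N) (fun=> 0%N).
rewrite !big1_eq => /(_ isT isT)/(bidegZ a); apply: bideg_ext => x y.
by rewrite /mono !big1 ?mulr1 // => k _; rewrite expr0.
Qed.

Lemma bideg_sum D E (I : Type) (s : seq I) (P : pred I)
    (g : I -> 'rV[R]_n -> 'rV[R]_q -> R) :
  (forall i, P i -> bideg D E (g i)) ->
  bideg D E (fun x y => \sum_(i <- s | P i) g i x y).
Proof.
move=> gP; elim: s => [|i s IH].
  by apply: bideg_ext (bideg_cst D E 0) => x y; rewrite big_nil.
case Pi: (P i); last by apply: bideg_ext IH => x y; rewrite big_cons Pi.
by apply: bideg_ext (bidegD (gP i Pi) IH) => x y; rewrite big_cons Pi.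
Qed.

Lemma bidegM D E D' E' g h : bideg D E g -> bideg D' E' h ->
  bideg (D + D') (E + E') (fun x y => g x y * h x y).
Proof.
move=> [c gE] [d hE].
have : bideg (D + D') (E + E') (fun x y => \sum_m \sum_m'
    (c m * d m') * (mono x (fun k => (exponent m.1 k + exponent m'.1 k)%N) *
                    mono y (fun k => (exponent m.2 k + exponent m'.2 k)%N))).
  apply: bideg_sum => m _; apply: bideg_sum => m' _; apply: bidegZ.
  by apply: bideg_mono; rewrite big_split leq_add // exponent_sum.
apply: bideg_ext => x y; rewrite gE hE big_distrl /=; apply: eq_bigr => m _.
rewrite big_distrr /=; apply: eq_bigr => m' _; rewrite !monoD; ring.
Qed.

Lemma bideg_le D E D' E' g : (D <= D')%N -> (E <= E')%N ->
  bideg D E g -> bideg D' E' g.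
Proof.
move=> /subnKC DD /subnKC EE gP.
have := bidegM gP (bideg_cst (D' - D) (E' - E) 1).
by rewrite DD EE; apply: bideg_ext => x y; rewrite mulr1.
Qed.

Lemma bideg_prod D E (I : Type) (s : seq I) (P : pred I) (d e : I -> nat)
    (g : I -> 'rV[R]_n -> 'rV[R]_q -> R) :
  (forall i, P i -> bideg (d i) (e i) (g i)) ->
  (\sum_(i <- s | P i) d i <= D)%N -> (\sum_(i <- s | P i) e i <= E)%N ->
  bideg D E (fun x y => \prod_(i <- s | P i) g i x y).
Proof.
move=> gP dD eE; apply: (bideg_le dD eE) => {D E dD eE}; elim: s => [|i s IH].
  rewrite !big_nil.
  by apply: bideg_ext (bideg_cst 0 0 1) => x y; rewrite big_nil.
rewrite !big_cons; case Pi: (P i).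
  by apply: bideg_ext (bidegM (gP i Pi) IH) => x y; rewrite big_cons Pi.
by apply: bideg_ext IH => x y; rewrite big_cons Pi.
Qed.

Lemma bideg_x (k : 'I_n) : @bideg n q 1 0 (fun x _ => x 0 k).
Proof.
have := @bideg_mono 1 0 (fun i => (i == k) : nat) (fun=> 0%N).
rewrite big1_eq (bigD1 k) //= eqxx big1 => [/(_ isT isT)|i /negPf -> //].
apply: bideg_ext => x y; rewrite /mono (bigD1 k) //= eqxx.
by rewrite !big1 ?mulr1 // => i /negPf ->.
Qed.

Lemma bideg_y (k : 'I_q) : @bideg n q 0 1 (fun _ y => y 0 k).
Proof.
have := @bideg_mono 0 1 (fun=> 0%N) (fun i => (i == k) : nat).
rewrite big1_eq (bigD1 k) //= eqxx big1 => [/(_ isT isT)|i /negPf -> //].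
apply: bideg_ext => x y; rewrite /mono [X in _ * X](bigD1 k) //= eqxx.
by rewrite !big1 ?mulr1 ?mul1r // => i /negPf ->.
Qed.
End Closure.

Arguments bideg_cst {n q}.
Arguments bideg_x {n q}.
Arguments bideg_y {n q}.

(* [lag] is a Lagrange polynomial in [x] within one fiber, [newtG] and [newtH] are
   Newton polynomials in the equations; the latter vanish at every grid point that
   does not dominate [(b, c)], so the products are triangular for [wt]. *)
Lemma grid_fiber_card (n q B C : nat) (J : finType)
    (G : 'I_n -> 'rV[R]_n -> 'rV[R]_q -> R)
    (H : 'I_q -> 'rV[R]_n -> 'rV[R]_q -> R)
    (px : ('I_n -> nat) -> ('I_q -> nat) -> J -> 'rV[R]_n)
    (py : ('I_n -> nat) -> ('I_q -> nat) -> J -> 'rV[R]_q) :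
  (forall m : nat, m.+1%:R != 0 :> R) ->
  (forall k, bideg 1 1 (G k)) -> (forall i, bideg 2 1 (H i)) ->
  (forall b c j k, G k (px b c j) (py b c j) = (b k)%:R) ->
  (forall b c j i, H i (px b c j) (py b c j) = (c i).+1%:R) ->
  (forall b c, injective (px b c)) ->
  (#|J| * ('C(n + B, n) * 'C(q + C, q)) <=
   'C(n + (#|J| + B + 2 * C), n) * 'C(q + (B + C), q))%N.
Proof.
move=> char0 GP HP Gb Hc px_inj.
pose I := ((expo n B * expo q C) * J)%type.
pose bb (i : I) := exponent i.1.1; pose cc (i : I) := exponent i.1.2.
pose ptx (i : I) := px (bb i) (cc i) i.2.
pose pty (i : I) := py (bb i) (cc i) i.2.
(* The factor for [j] is a coordinate difference separating the fiber points of [j] and [i.2]. The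
   default [1] would mean that these points coincide, which [px_inj] excludes. *)
pose lag (i : I) (x : 'rV[R]_n) (y : 'rV[R]_q) := \prod_(j | j != i.2)
  oapp (fun k => x 0 k - px (bb i) (cc i) j 0 k) 1
       [pick k | px (bb i) (cc i) j 0 k != px (bb i) (cc i) i.2 0 k].
pose newtG (i : I) x y := \prod_k \prod_(t < bb i k) (G k x y - t%:R).
pose newtH (i : I) x y := \prod_k \prod_(t < cc i k) (H k x y - t.+1%:R).
pose phi (i : I) x y := lag i x y * (newtG i x y * newtH i x y).
have natr_eq (a b : nat) : (a%:R == b%:R :> R) = (a == b).
  wlog ab : a b / (a <= b)%N.
    by move=> W; case/orP: (leq_total a b) => /W // e; rewrite eq_sym e eq_sym.
  rewrite -(subnKC ab); move: (b - a)%N => m.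
  rewrite natrD -subr_eq0 opprD addrA subrr add0r oppr_eq0.
  rewrite -[X in _ = (X == _)]addn0 eqn_add2l.
  by case: m => [|m]; rewrite ?eqxx // (negPf (char0 m)).
have newtE (m : nat) (a : nat) :
    (\prod_(t < m) (a%:R - t%:R : R) != 0) = (m <= a)%N.
  apply/prodf_neq0/idP => [ma|ma t _]; last first.
    by rewrite subr_eq0 natr_eq neq_ltn (leq_trans (ltn_ord t) ma) orbT.
  rewrite leqNgt; apply/negP => am.
  by have := ma (Ordinal am) isT; rewrite /= subrr eqxx.
(* Shifted by one, since [H] takes the values [(c i).+1] whereas [G] takes the values [b k]. *)
have newtHE (m : nat) (a : nat) :
    (\prod_(t < m) (a.+1%:R - t.+1%:R : R) != 0) = (m <= a)%N.
  rewrite -newtE; congr (_ != 0); apply: eq_bigr => t _.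
  by rewrite -!natr1; ring.
have phi_bideg i : bideg (#|J| + B + 2 * C) (B + C) (phi i).
  have lagP : bideg #|J| 0 (lag i).
    apply: (bideg_prod (d := fun=> 1%N) (e := fun=> 0%N)) => [j _||].
    - case: pickP => [k _|_] /=; last exact: bideg_cst.
      have := bidegD (bideg_x (q := q) k) (bideg_cst 1 0 (- px (bb i) (cc i) j 0 k)).
      by apply: bideg_ext => x y.
    - by rewrite sum1dep_card max_card.
    - by rewrite big1.
  have newtGP : bideg B B (newtG i).
    have bB : (\sum_k \sum_(t < bb i k) 1 <= B)%N.
      under eq_bigr do rewrite sum1_card card_ord.
      exact: exponent_sum.
    apply: (bideg_prod (d := fun k => (\sum_(t < bb i k) 1)%N)
                       (e := fun k => (\sum_(t < bb i k) 1)%N)) (bB) (bB) => k _.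
    apply: (bideg_prod (d := fun=> 1%N) (e := fun=> 1%N)) => // t _.
    by have := bidegD (GP k) (bideg_cst 1 1 (- t%:R)); by apply: bideg_ext => x y.
  have newtHP : bideg (2 * C) C (newtH i).
    have cC : (\sum_k \sum_(t < cc i k) 1 <= C)%N.
      under eq_bigr do rewrite sum1_card card_ord.
      exact: exponent_sum.
    have c2C : (\sum_k \sum_(t < cc i k) 2 <= 2 * C)%N.
      apply: leq_trans (leq_mul (leqnn 2) cC); rewrite big_distrr /=.
      by apply: leq_sum => k _; rewrite big_distrr.
    apply: (bideg_prod (d := fun k => (\sum_(t < cc i k) 2)%N)
                       (e := fun k => (\sum_(t < cc i k) 1)%N)) (c2C) (cC) => k _.
    apply: (bideg_prod (d := fun=> 2%N) (e := fun=> 1%N)) => // t _.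
    by have := bidegD (HP k) (bideg_cst 2 1 (- t.+1%:R)); by apply: bideg_ext => x y.
  have := bidegM lagP (bidegM newtGP newtHP); rewrite addnA add0n.
  by apply: bideg_ext => x y.
have newtG_pt i j : newtG i (ptx j) (pty j) != 0 -> forall k, (bb i k <= bb j k)%N.
  move=> /prodf_neq0 N k; rewrite -newtE; have := N k isT.
  by under eq_bigr do rewrite Gb.
have newtH_pt i j : newtH i (ptx j) (pty j) != 0 -> forall k, (cc i k <= cc j k)%N.
  move=> /prodf_neq0 N k; rewrite -newtHE; have := N k isT.
  by under eq_bigr do rewrite Hc.
pose wt i := (\sum_k bb i k + \sum_k cc i k)%N.
pose M := (expo n (#|J| + B + 2 * C) * expo q (B + C))%type.
have [cf cfE] : exists cf : I -> M -> R, forall i x y, phi i x y =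
    \sum_m cf i m * (mono x (exponent m.1) * mono y (exponent m.2)).
  by exists (fun i => sval (cid (phi_bideg i))) => i; exact: (svalP (cid (phi_bideg i))).
have -> : (#|J| * ('C(n + B, n) * 'C(q + C, q)) = #|{: I}|)%N.
  by rewrite !card_prod !card_expo mulnC.
have -> : ('C(n + (#|J| + B + 2 * C), n) * 'C(q + (B + C), q) = #|{: M}|)%N.
  by rewrite card_prod !card_expo.
apply: (@triangular_card _ _ ('rV[R]_n * 'rV[R]_q)%type
  (fun i p => phi i p.1 p.2) (fun m p => mono p.1 (exponent m.1) * mono p.2 (exponent m.2))
  cf (fun i => (ptx i, pty i)) wt) => [i p|i|i j ij wji] /=; first exact: cfE.
- rewrite !mulf_neq0 //.
  + apply/prodf_neq0 => j ji; case: pickP => [k /=|/= e].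
      by rewrite subr_eq0 eq_sym.
    have/px_inj : px (bb i) (cc i) j = px (bb i) (cc i) i.2.
      by apply/rowP => k; have /negbFE/eqP := e k.
    by move/eqP; rewrite (negPf ji).
  + apply/prodf_neq0 => k _; under eq_bigr do rewrite Gb.
    by rewrite newtE.
  + apply/prodf_neq0 => k _; under eq_bigr do rewrite Hc.
    by rewrite newtHE.
(* Nonvanishing at the point of [j] bounds the exponents of [i] by those of [j], and [wji] turns
   this into equality. Both points then lie in one fiber, where [lag] separates them. *)
- apply: contraNeq ij; rewrite /phi !mulf_eq0 !negb_or => /and3P [lagN].
  move=> /newtG_pt leb /newtH_pt lec.
  have sb : (\sum_k bb i k <= \sum_k bb j k)%N by apply: leq_sum.
  have sc : (\sum_k cc i k <= \sum_k cc j k)%N by apply: leq_sum.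
  have eb : bb i =1 bb j by apply: sum_leq_eq => //; rewrite /wt in wji; lia.
  have ec : cc i =1 cc j by apply: sum_leq_eq => //; rewrite /wt in wji; lia.
  move: i j lagN {newtG_pt newtH_pt leb lec sb sc wji} eb ec.
  move=> [[b c] j] [[b' c'] j'] /= lagN /exponent_inj /= eb /exponent_inj /= ec.
  move: lagN; rewrite /lag /ptx /bb /cc /= {}eb {}ec => /prodf_neq0 N.
  suff -> : j = j' by [].
  apply/eqP; apply/negPn/negP => jj'.
  have := N j'; rewrite eq_sym jj' => /(_ isT); case: pickP => [k _|e] /=.
    by rewrite subrr eqxx.
  have /px_inj e' : px (exponent b') (exponent c') j' = px (exponent b') (exponent c') j.
    by apply/rowP => k; have /negbFE/eqP := e k.
  by rewrite e' eqxx in jj'.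
Qed.
End Bidegree.

(** * Sign patterns of quadratic forms *)

(** Logarithmic differentiation; the weights [(m i).+1 / p i] are the future multipliers [y_i]. *)
Lemma deriv_prod_pow (F : fieldType) (I : Type) (s : seq I) (p : I -> {poly F})
    (m : I -> nat) (x : F) : (forall i, (p i).[x] != 0) ->
  (\prod_(i <- s) p i ^+ (m i).+1)^`().[x] =
  (\prod_(i <- s) p i ^+ (m i).+1).[x] *
  \sum_(i <- s) (m i).+1%:R / (p i).[x] * (p i)^`().[x].
Proof.
move=> px; elim: s => [|i s IH].
  by rewrite !big_nil mulr0 -polyC1 derivC horner0.
rewrite !big_cons derivM hornerD hornerM hornerM IH deriv_exp hornerM.
rewrite hornerMn hornerM !horner_exp /= exprS -mulr_natr.
by field; exact: px.
Qed.

Lemma poly_local_max (R : realType) (p : {poly R}) (e : R) : 0 < e ->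
  (forall t, `|t| < e -> p.[t] <= p.[0]) -> p^`().[0] = 0.
Proof.
move=> e0 pmax.
have max0 : is_derive (0 : R) 1 (horner p) 0.
  apply: (@derive1_at_max _ _ (- e) e).
  - by rewrite ge0_cp // ltW.
  - by move=> t _; exact: derivable_horner.
  - by rewrite in_itv /= oppr_lt0 e0.
  - by move=> t; rewrite in_itv /= -ltr_norml; exact: pmax.
have [_ e1] := max0; have [_ e2] := is_derive_poly p 0.
by rewrite -e2 e1.
Qed.

Lemma uniform_radius (R : realFieldType) (I : finType) (P : I -> R -> Prop) :
  (forall i, exists2 e, 0 < e & forall t, `|t| < e -> P i t) ->
  exists2 e, 0 < e & forall t, `|t| < e -> forall i, P i t.
Proof.
move=> /(_ _)/cid2-/all_sig2 [e e0 eP].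
(* The initial value [1] keeps the minimum positive when [I] is empty. *)
exists (\big[Order.min/1]_i e i) => [|t te i].
  by elim/big_ind : _ => // x y x0 y0; rewrite lt_min x0.
by apply: eP; apply: lt_le_trans te _; rewrite (bigD1 i) //= ge_min lexx.
Qed.

Section QuadraticForms.
Variable R : realType.
Implicit Types (n q N : nat).

Definition quad n (S : 'M[R]_n) (s : R) (w : 'rV[R]_n) : R :=
  (w *m S *m w^T) 0 0 + s.

(** The partial derivative of [quad S s] along coordinate [k], for symmetric [S]. *)
Definition dquad n (S : 'M[R]_n) (w : 'rV[R]_n) (k : 'I_n) : R :=
  2 * (w *m S) 0 k.

Lemma quadE n (S : 'M[R]_n) s w :
  quad S s w = \sum_k (\sum_l w 0 l * S l k) * w 0 k + s.
Proof.
rewrite /quad mxE; congr (_ + _); apply: eq_bigr => k _.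
by rewrite mxE; congr (_ * _); rewrite mxE.
Qed.

(** Exact Taylor expansion along a coordinate line: symmetry merges the two cross terms. Partial
    derivatives thus become derivatives of one-variable polynomials. *)
Lemma quad_line n (S : 'M[R]_n) s w k t : S^T = S ->
  quad S s (w + t *: delta_mx 0 k) =
  quad S s w + dquad S w k * t + S k k * t ^+ 2.
Proof.
move=> Ssym; set d := delta_mx 0 k : 'rV[R]_n.
have wSd : w *m S *m d^T = const_mx ((w *m S) 0 k).
  by apply/matrixP => i j; rewrite !ord1 trmx_delta -colE !mxE.
have dSw : d *m S *m w^T = const_mx ((w *m S) 0 k).
  rewrite (_ : _ *m w^T = (w *m S *m d^T)^T); last first.
    by rewrite !trmx_mul trmxK Ssym mulmxA.
  rewrite wSd.
  by apply/matrixP => i j; rewrite !mxE.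
have dSd : d *m S *m d^T = const_mx (S k k).
  by apply/matrixP => i j; rewrite !ord1 trmx_delta -colE -rowE !mxE.
rewrite /quad /dquad linearD linearZ /= !mulmxDl !mulmxDr.
rewrite -!scalemxAl -!scalemxAr wSd dSw dSd.
have -> : (w *m S *m w^T) = const_mx ((w *m S *m w^T) 0 0).
  by apply/matrixP => i j; rewrite !ord1 [RHS]mxE.
move: (_ 0 0) (_ 0 k) => x y; rewrite !mxE; ring.
Qed.

Lemma continuous_bigsum (T : topologicalType) (I : Type) (s : seq I) (F : I -> T -> R) :
  (forall i, continuous (F i)) -> continuous (fun x => \sum_(i <- s) F i x).
Proof.
move=> Fc x; apply: cvg_big => [|i _]; last exact: Fc.
exact: add_continuous.
Qed.

Lemma continuous_bigprod (T : topologicalType) (I : Type) (s : seq I) (F : I -> T -> R) :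
  (forall i, continuous (F i)) -> continuous (fun x => \prod_(i <- s) F i x).
Proof.
move=> Fc x; apply: cvg_big => [|i _]; last exact: Fc.
exact: mul_continuous.
Qed.

Lemma continuous_mul (T : topologicalType) (f g : T -> R) :
  continuous f -> continuous g -> continuous (fun x => f x * g x).
Proof. by move=> fc gc x; apply: cvgM; [exact: fc | exact: gc]. Qed.

Lemma continuous_quad n (S : 'M[R]_n) s : continuous (quad S s).
Proof.
rewrite (_ : quad S s = fun w => \sum_k (\sum_l w 0 l * S l k) * w 0 k + s).
  move=> w; apply: (@continuousD _ _ _ _ (cst s)); last exact: cst_continuous.
  apply: continuous_bigsum => k; apply: continuous_mul; last exact: coord_continuous.
  apply: continuous_bigsum => l; apply: continuous_mul; last exact: cst_continuous.
  exact: coord_continuous.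
by apply/funext => w; exact: quadE.
Qed.

(* The point is a maximizer of [expR (- b . w) * \prod_i (quad w) ^+ (c i).+1]
   over the closed cell: this product vanishes on the boundary of the cell. *)
Lemma cell_critical_point n q (S : 'I_q -> 'M[R]_n) (s : 'I_q -> R)
    (b : 'I_n -> nat) (c : 'I_q -> nat) (w0 : 'rV[R]_n) (M : R) :
  (forall i, (S i)^T = S i) -> (forall i, 0 < quad (S i) (s i) w0) ->
  (forall w, (forall i, 0 <= quad (S i) (s i) w) -> forall k, `|w 0 k| <= M) ->
  exists w, (forall i, 0 < quad (S i) (s i) w) /\
    forall k, \sum_i (c i).+1%:R / quad (S i) (s i) w * dquad (S i) w k = (b k)%:R.
Proof.
move=> Ssym w0P bounded; pose g i := quad (S i) (s i).
pose A := [set w | forall i, 0 <= g i w]%classic.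
pose lin (w : 'rV[R]_n) := \sum_k (b k)%:R * w 0 k.
pose Psi w := \prod_i g i w ^+ (c i).+1 * expR (- lin w).
have Acompact : compact A.
  pose box := [set v : 'rV[R]_n | forall i, (v ord0 i \in `[(- M), M])%R]%classic.
  apply: (@subclosed_compact _ A box).
  - have -> : A = (\bigcap_(i in setT) (g i @^-1` [set x | 0 <= x]))%classic.
      by apply/seteqP; split => w wA i; [move=> _; exact: wA | exact: (wA i I)].
    apply: closed_bigI => i _; apply: preimage_closed; last exact: closed_ge.
    by move=> w _; exact: continuous_quad.
  - rewrite /box; apply: (@rV_compact R _ (fun=> `[(- M), M]%classic)) => _.
    exact: segment_compact.
  - by move=> w /bounded wM i; rewrite in_itv /= -ler_norml wM.
have Psi_cont : continuous Psi.
  apply: continuous_mul.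
    apply: continuous_bigprod => i v.
    apply: (@continuous_comp _ _ _ (g i) (fun x : R => x ^+ (c i).+1)).
      exact: continuous_quad.
    exact: exprn_continuous.
  move=> w; apply: (@continuous_comp _ _ _ (fun v => - lin v) expR).
    apply: continuousN; apply: continuous_bigsum => k; apply: continuous_mul.
      exact: cst_continuous.
    exact: coord_continuous.
  exact: continuous_expR.
have A0 : (A !=set0)%classic by exists w0 => i; apply/ltW/w0P.
have [w wA wmax] := EVT_max_rV A0 Acompact (continuous_subspaceT Psi_cont).
have {}wA i : 0 <= g i w by move: wA; rewrite inE => /(_ i).
have {}wmax v : (forall i, 0 <= g i v) -> Psi v <= Psi w.
  by move=> vA; apply: wmax; rewrite inE.
(* A vanishing factor would give [Psi w = 0], below the positive value [Psi w0]. *)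
have gw i : 0 < g i w.
  rewrite lt_def wA andbT; apply/negP => /eqP gi0.
  have := wmax w0 (fun i => ltW (w0P i)).
  rewrite /Psi (bigD1 i _ (F := fun i => g i w ^+ _)) //= gi0 expr0n !mul0r leNgt.
  rewrite mulr_gt0 ?expR_gt0 //; apply: prodr_gt0 => j _; apply/exprn_gt0/w0P.
exists w; split=> // k.
pose p i : {poly R} := (g i w)%:P + dquad (S i) w k *: 'X + S i k k *: 'X^2.
have pE i t : (p i).[t] = g i (w + t *: delta_mx 0 k).
  by rewrite /g quad_line // /p !hornerE.
have p0 i : (p i).[0] = g i w by rewrite pE scale0r addr0.
have dp0 i : (p i)^`().[0] = dquad (S i) w k.
  by rewrite /p !poly.derivE !hornerE /=; ring.
pose P := \prod_i p i ^+ (c i).+1.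
(* The exponential is replaced by its tangent line, so that [Q] is a polynomial. As
   [1 - b t <= exp (- b t)] and [P] is nonnegative near [0], [Q] inherits the local maximum at [0];
   the vanishing of its derivative there is the required equation. *)
pose Q := P * (1 - (b k)%:R *: 'X).
have [e e0 eP] : exists2 e, 0 < e & forall t, `|t| < e ->
    forall i, 0 <= g i (w + t *: delta_mx 0 k).
  apply: uniform_radius => i.
  have : 0 < (p i).[0] by rewrite p0.
  move=> /(cvgr_gt _ (@continuous_horner _ (p i) 0)).
  move=> /nbhs_ballP [e /= e0 eP]; exists e => // t te.
  by rewrite -pE ltW //; apply: eP; rewrite /ball /= sub0r normrN.
have PE t : P.[t] = \prod_i g i (w + t *: delta_mx 0 k) ^+ (c i).+1.
  by rewrite horner_prod; apply: eq_bigr => i _; rewrite horner_exp pE.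
have P0 : 0 < P.[0].
  rewrite PE scale0r addr0; apply: prodr_gt0 => i _; apply/exprn_gt0/gw.
have Qmax t : `|t| < e -> Q.[t] <= Q.[0].
  move=> te; have := wmax _ (eP t te); rewrite /Psi -PE.
  have -> : lin (w + t *: delta_mx 0 k) = lin w + (b k)%:R * t.
    rewrite /lin; under eq_bigr do rewrite mxE mulrDr.
    rewrite big_split /=; congr (_ + _); rewrite (bigD1 k) //= big1 => [|i ik].
      by rewrite !mxE !eqxx mulr1 addr0.
    by rewrite !mxE (negPf ik) !mulr0.
  have -> : \prod_i g i w ^+ (c i).+1 = P.[0] by rewrite PE scale0r addr0.
  rewrite opprD expRD mulrCA [P.[0] * _]mulrC ler_pM2l ?expR_gt0 // => le_P0.
  rewrite /Q !hornerE subr0 mulr1; apply: le_trans le_P0.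
  apply: ler_wpM2l; last by rewrite expR_ge1Dx.
  by rewrite PE prodr_ge0 // => i _; rewrite exprn_ge0 // eP.
have p0N i : (p i).[0] != 0 by rewrite p0 gt_eqF.
have := poly_local_max e0 Qmax.
rewrite /Q derivM hornerD !hornerM deriv_prod_pow // -/P !poly.derivE !hornerE.
rewrite subr0 mulr1 -mulrDr => /eqP; rewrite mulf_eq0 gt_eqF //= subr_eq0 => /eqP <-.
by apply: eq_bigr => i _; rewrite p0 dp0.
Qed.

Lemma bideg_quad n q (S : 'M[R]_n) s : @bideg R n q 2 0 (fun x _ => quad S s x).
Proof.
have : @bideg R n q 2 0 (fun x _ => \sum_k (\sum_l x 0 l * S l k) * x 0 k + s).
  apply: bidegD; last exact: bideg_cst.
  apply: bideg_sum => k _; apply: (@bidegM _ _ _ 1 0 1 0); last exact: bideg_x.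
  apply: bideg_sum => l _; apply: (@bidegM _ _ _ 1 0 0 0); first exact: bideg_x.
  exact: bideg_cst.
by apply: bideg_ext => x y; rewrite quadE.
Qed.

Lemma bideg_dquad n q (S : 'M[R]_n) k : @bideg R n q 1 0 (fun x _ => dquad S x k).
Proof.
have : @bideg R n q 1 0 (fun x _ => 2 * \sum_l x 0 l * S l k).
  apply: bidegZ; apply: bideg_sum => l _.
  by apply: (@bidegM _ _ _ 1 0 0 0); [exact: bideg_x | exact: bideg_cst].
by apply: bideg_ext => x y; rewrite /dquad mxE.
Qed.

Lemma quadZ n (S : 'M[R]_n) a s w : quad (a *: S) (a * s) w = a * quad S s w.
Proof. by rewrite /quad -scalemxAr -scalemxAl mxE mulrDr. Qed.

Lemma dquadZ n (S : 'M[R]_n) a w k : dquad (a *: S) w k = a * dquad S w k.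
Proof. by rewrite /dquad -scalemxAr mxE mulrCA. Qed.

Lemma quad_ball n (rho : R) (w : 'rV[R]_n) :
  quad (- 1%:M) rho w = rho - \sum_k w 0 k ^+ 2.
Proof.
rewrite quadE addrC -sumrN; congr (_ + _); apply: eq_bigr => k _.
rewrite (bigD1 k) //= big1 => [|l lk]; rewrite !mxE ?eqxx; last first.
  by rewrite (negPf lk) oppr0 mulr0.
by rewrite addr0 mulrN1 mulNr expr2.
Qed.

(** Index [ord0] carries the ball form. Multiplying the forms by the signs [sg I] makes the cell of
    [I] a positive cell for [cell_critical_point]. The signs cancel in [dquad / quad], so the points
    of all cells solve the same equations and [grid_fiber_card] applies with one fiber point per
    [I]. *)
Lemma sign_patterns_grid n N (S : 'I_N -> 'M[R]_n) (s : 'I_N -> R) (B C : nat) :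
  (forall i, (S i)^T = S i) ->
  (forall I : {set 'I_N}, exists w, forall i,
     (i \in I -> 0 < quad (S i) (s i) w) /\
     (i \notin I -> quad (S i) (s i) w < 0)) ->
  (2 ^ N * ('C(n + B, n) * 'C(N.+1 + C, N.+1)) <=
   'C(n + (2 ^ N + B + 2 * C), n) * 'C(N.+1 + (B + C), N.+1))%N.
Proof.
move=> Ssym /choice [w wP].
(* Large enough for all the chosen witnesses to lie strictly inside the ball. *)
pose rho := 1 + \sum_I \sum_k w I 0 k ^+ 2.
have rhoP I : 0 < rho - \sum_k w I 0 k ^+ 2.
  rewrite /rho (bigD1 I) //= addrA addrAC addrK ltr_wpDr //.
  by apply: sumr_ge0 => J _; apply: sumr_ge0 => k _; exact: sqr_ge0.
pose F (i : 'I_N.+1) := oapp S (- 1%:M) (unlift ord0 i).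
pose f (i : 'I_N.+1) := oapp s rho (unlift ord0 i).
pose sg (I : {set 'I_N}) (i : 'I_N.+1) : R :=
  oapp (fun j => if j \in I then 1 else -1) 1 (unlift ord0 i).
have sg2 I i : sg I i * sg I i = 1.
  by rewrite /sg; case: unliftP => [j _|_] /=; [case: ifP => _|]; ring.
have Fsym i : (F i)^T = F i.
  by rewrite /F; case: unliftP => [j _|_] /=; rewrite ?Ssym // linearN /= trmx1.
have crit b c I : exists x,
    (forall i, 0 < sg I i * quad (F i) (f i) x) /\
    forall k, \sum_i (c i).+1%:R / quad (F i) (f i) x * dquad (F i) x k = (b k)%:R.
  have [|i|x xP k|x [xP xE]] := @cell_critical_point n N.+1
      (fun i => sg I i *: F i) (fun i => sg I i * f i) b c (w I) (rho + 1).
  - by move=> i; rewrite linearZ /= Fsym.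
  - rewrite quadZ /sg /F /f; case: unliftP => [j _|_] /=.
      have [wpos wneg] := wP I j; case: ifP => jI.
        by rewrite mul1r wpos.
      by rewrite mulN1r oppr_gt0 wneg ?jI.
    by rewrite mul1r quad_ball.
  - have := xP ord0; rewrite quadZ /sg /F /f unlift_none /= mul1r quad_ball.
    rewrite subr_ge0 (bigD1 k) //= => le_rho.
    have xk : x 0 k ^+ 2 <= rho.
      by apply: le_trans le_rho; rewrite lerDl sumr_ge0 // => i _; exact: sqr_ge0.
    (* From [2 |x_k| <= x_k ^ 2 + 1] the bound [rho + 1] follows without a square root. *)
    rewrite -real_normK ?num_real // in xk.
    have := normr_ge0 (x 0 k); have := sqr_ge0 (`|x 0 k| - 1); nra.
  - exists x; split=> [i|k]; first by rewrite -quadZ.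
    rewrite -xE; apply: eq_bigr => i _; rewrite quadZ dquadZ.
    have sg0 : sg I i != 0.
      apply/eqP => s0; have := sg2 I i.
      by rewrite s0 mul0r => /eqP; rewrite eq_sym oner_eq0.
    have f0 : quad (F i) (f i) x != 0.
      by have := xP i; rewrite quadZ; case: eqP => // ->; rewrite mulr0 ltxx.
    by field; rewrite sg0 f0.
pose px b c I := sval (cid (crit b c I)).
have pxP b c I := svalP (cid (crit b c I)) : _ /\ _.
pose py b c I : 'rV[R]_N.+1 := \row_i ((c i).+1%:R / quad (F i) (f i) (px b c I)).
have quad_neq0 b c I i : quad (F i) (f i) (px b c I) != 0.
  have [/(_ i) xP _] := pxP b c I.
  by apply: contraTneq xP => e; rewrite -/(px b c I) e mulr0 ltxx.
have cardJ : #|{set 'I_N}| = (2 ^ N)%N by rewrite -cardsT -powersetT card_powerset cardsT card_ord.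
rewrite -cardJ.
apply: (@grid_fiber_card R n N.+1 B C {set 'I_N}
   (fun k x y => \sum_i y 0 i * dquad (F i) x k)
   (fun i x y => y 0 i * quad (F i) (f i) x) px py).
- by move=> m; rewrite pnatr_eq0.
- move=> k; apply: bideg_sum => i _; apply: (@bidegM _ _ _ 0 1 1 0).
    exact: bideg_y.
  exact: bideg_dquad.
- move=> i; apply: (@bidegM _ _ _ 0 1 2 0); first exact: bideg_y.
  exact: bideg_quad.
- move=> b c I k; have [_ <-] := pxP b c I.
  by apply: eq_bigr => i _; rewrite mxE.
- by move=> b c I i; rewrite mxE mulfVK.
(* The signs of the forms at the point recover the set [I]. *)
- move=> b c I J IJ; apply/setP => j.
  have [/(_ (lift ord0 j)) xI _] := pxP b c I.
  have [/(_ (lift ord0 j)) xJ _] := pxP b c J.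
  move: xI xJ; rewrite -/(px b c I) -/(px b c J) IJ /sg liftK /=.
  by case: (j \in I) (j \in J) => [] [] //; lra.
Qed.
End QuadraticForms.

(** * Numerical estimates and the linear bound on sign patterns *)

(** The quotient of the binomials is the product of [(k + b) / (k + a)] for [k] from [1] to [n], and
    each factor is at most [b / a]; stated without division. *)
Lemma bin_ratio n a b : (a <= b)%N ->
  ('C(n + b, n) * a ^ n <= 'C(n + a, n) * b ^ n)%N.
Proof.
move=> ab; elim: n => [|n IH]; first by rewrite !bin0.
have diag c : (n.+1 * 'C(n.+1 + c, n.+1) = (n.+1 + c) * 'C(n + c, n))%N.
  by rewrite addSn -mul_bin_diag.
rewrite -(leq_pmul2l (ltn0Sn n)) !mulnA !diag !expnS.
have : ((n.+1 + b) * a <= (n.+1 + a) * b)%N by nia.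
move=> /leq_mul/(_ IH); congr (_ <= _)%N; ring.
Qed.

(** If [N > 8 n], keep [m = 8 n - 1] forms, so that there are [8 n] with the ball. A grid of sizes
    [X] and [8 X], with [X = n 2 ^ m] absorbing the term [2 ^ m], gives
    [2 ^ m <= 18 ^ n (9 / 8) ^ (8 n)], which is false. *)
Lemma sign_patterns_bound (R : realType) n N (S : 'I_N -> 'M[R]_n) (s : 'I_N -> R) :
  (0 < n)%N -> (forall i, (S i)^T = S i) ->
  (forall I : {set 'I_N}, exists w, forall i,
     (i \in I -> 0 < quad (S i) (s i) w) /\
     (i \notin I -> quad (S i) (s i) w < 0)) ->
  (N <= 8 * n)%N.
Proof.
move=> n0 Ssym pat; rewrite leqNgt; apply/negP => ltN.
pose m := (8 * n).-1; have m1 : m.+1 = (8 * n)%N by rewrite prednK ?muln_gt0.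
have mN : (m <= N)%N by lia.
pose K := (2 ^ m)%N; pose X := (n * K)%N.
have K0 : (0 < K)%N by rewrite expn_gt0.
have X0 : (0 < X)%N by rewrite muln_gt0 n0.
have := @sign_patterns_grid R n m (S \o widen_ord mN) (s \o widen_ord mN) X (8 * X).
rewrite -/K m1 => /(_ (fun i => Ssym _)) grid.
have {}grid : (K * ('C(n + X, n) * 'C(8 * n + 8 * X, 8 * n)) <=
    'C(n + 18 * X, n) * 'C(8 * n + 9 * X, 8 * n))%N.
  apply: leq_trans (grid _) _ => [I|].
    have [w wP] := pat [set widen_ord mN i | i in I]; exists w => i.
    have := wP (widen_ord mN i); rewrite mem_imset //.
    by move=> x y /(congr1 val) /= xy; exact: val_inj.
  apply: leq_mul; apply: leq_bin2l; rewrite leq_add2l; last lia.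
  have : (K <= X)%N by rewrite leq_pmull.
  lia.
have XX a : (X <= a.+1 * X)%N by rewrite leq_pmull.
have r1 := @bin_ratio n X (18 * X) (XX _).
have r2 := @bin_ratio (8 * n) (8 * X) (9 * X) ltac:(lia).
have p1 : (0 < 'C(n + X, n))%N by rewrite bin_gt0 leq_addr.
have p2 : (0 < 'C(8 * n + 8 * X, 8 * n))%N by rewrite bin_gt0 leq_addr.
have {grid} : (K * (X ^ n * (8 * X) ^ (8 * n)) <=
    (18 * X) ^ n * (9 * X) ^ (8 * n))%N.
  rewrite -(leq_pmul2l p1) -(leq_pmul2l p2).
  have h1 := leq_mul grid (leqnn (X ^ n * (8 * X) ^ (8 * n))).
  have h2 := leq_mul r1 r2.
  apply: leq_trans (_ : _ <= 'C(n + 18 * X, n) * X ^ n *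
     ('C(8 * n + 9 * X, 8 * n) * (8 * X) ^ (8 * n)))%N _.
    by apply: leq_trans (leq_trans h1 _); apply/eq_leq; ring.
  by apply: leq_trans h2 _; apply/eq_leq; ring.
clearbody X; rewrite !expnMn -!mulnA.
have -> : (K * (X ^ n * (8 ^ (8 * n) * X ^ (8 * n))) =
   X ^ n * X ^ (8 * n) * (K * 8 ^ (8 * n)))%N by ring.
have -> : (18 ^ n * (X ^ n * (9 ^ (8 * n) * X ^ (8 * n))) =
   X ^ n * X ^ (8 * n) * (18 ^ n * 9 ^ (8 * n)))%N by ring.
rewrite leq_pmul2l ?muln_gt0 ?expn_gt0 ?X0 // leqNgt => /negP; apply.
(* Doubling turns [2 ^ m] into [2 ^ (8 n)]; since [2 * 18 ^ n <= 36 ^ n], it remains to compare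
   [36 * 9 ^ 8 < 2 ^ 8 * 8 ^ 8]. *)
rewrite -(ltn_pmul2l (isT : 0 < 2)%N) /K [(2 * (2 ^ m * _))%N]mulnA -expnS m1.
apply: (@leq_ltn_trans (36 ^ n * 9 ^ (8 * n))%N).
  rewrite mulnA leq_mul2r; apply/orP; right.
  rewrite (expnMn 2 18 n : 36 ^ n = _)%N leq_mul2r; apply/orP; right.
  by rewrite -{1}(expn1 2) leq_pexp2l.
rewrite !expnM -!expnMn ltn_exp2r; [lia | exact: n0].
Qed.

(** * The loss for a one-row sketch *)

Section SCWLoss.
Variable R : realType.
Implicit Types (n d : nat).

Lemma frob_sqr n d (M : 'M[R]_(n, d)) : frob M ^+ 2 = \tr (M *m M^T).
Proof.
rewrite sqr_sqrtr; last by do 2![apply: sumr_ge0 => ? _]; exact: sqr_ge0.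
by apply: eq_bigr => i _; rewrite mxE; apply: eq_bigr => j _; rewrite mxE expr2.
Qed.

Lemma frob_ge0 n d (M : 'M[R]_(n, d)) : 0 <= frob M.
Proof. exact: sqrtr_ge0. Qed.

Lemma frob0 n d : frob (0 : 'M[R]_(n, d)) = 0.
Proof. by apply/eqP; rewrite -sqrf_eq0 frob_sqr mul0mx raddf0. Qed.

Lemma frob_eq0 n d (M : 'M[R]_(n, d)) : frob M = 0 -> M = 0.
Proof.
rewrite /frob => /eqP; rewrite sqrtr_eq0 => M0.
have ge0 i : 0 <= \sum_j M i j ^+ 2 by apply: sumr_ge0 => j _; exact: sqr_ge0.
have {}M0 : \sum_i \sum_j M i j ^+ 2 = 0.
  by apply/le_anti; rewrite M0 sumr_ge0.
apply/matrixP => i j; rewrite mxE; apply/eqP; rewrite -sqrf_eq0; apply/eqP.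
have rowi := psumr_eq0P (fun i _ => ge0 i) M0 (i := i) isT.
exact: (psumr_eq0P (fun j _ => sqr_ge0 (M i j)) rowi isT).
Qed.

(* For a nonzero row [u], [u^T u / |u|^2] is the projection [V V^T] onto its line. *)
Definition line_proj d (u : 'rV[R]_d) : 'M[R]_d :=
  ((u *m u^T) 0 0)^-1 *: (u^T *m u).

Lemma row_sqr_gt0 d (u : 'rV[R]_d) : u != 0 -> 0 < (u *m u^T) 0 0.
Proof.
move=> u0; rewrite lt_def; apply/andP; split; last first.
  by rewrite mxE sumr_ge0 // => k _; rewrite mxE -expr2 sqr_ge0.
apply: contraNneq u0 => uu0; apply/eqP/frob_eq0/eqP.
by rewrite -sqrf_eq0 frob_sqr /mxtrace big_ord1 uu0.
Qed.

(** A thin SVD of a nonzero row has a single singular value, and [V] is a unit vector on the line of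
    the row, unique up to a sign that cancels in [V V^T]. *)
Lemma is_SCW_row n d (w : 'cV[R]_n) (A : 'M[R]_(n, d)) (M : 'M[R]_(n, d)) :
  w^T *m A != 0 -> is_SCW 1 w^T A M <-> M = A *m line_proj (w^T *m A).
Proof.
rewrite /is_SCW; move: (w^T *m A) => u u0.
have nu0 := row_sqr_gt0 u0; split; last first.
  (* Witnesses: the singular value is the norm [a] of [u], and [V] is [u^T / a]. *)
  move=> ->; right; split=> //; pose a := Num.sqrt ((u *m u^T) 0 0).
  have a2 : a * a = (u *m u^T) 0 0 by rewrite -expr2 sqr_sqrtr // ltW.
  have a0 : 0 < a by rewrite sqrtr_gt0.
  have aN0 : a != 0 by rewrite gt_eqF.
  have VT : (a^-1 *: u^T)^T = a^-1 *: u by rewrite linearZ /= trmxK.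
  have uu : u *m u^T = (a * a)%:M by rewrite a2 -mx11_scalar.
  exists 1, 1%:M, (const_mx a), (a^-1 *: u^T); split.
    split.
    - rewrite mul1mx VT diag_const_mx mul_scalar_mx scalerA mulfV //.
      by rewrite scale1r.
    - by rewrite trmx1 mulmx1.
    - rewrite VT -scalemxAr -scalemxAl scalerA uu scale_scalar_mx -invfM.
      by rewrite mulVf // mulf_neq0.
    - by move=> i; rewrite mxE.
  exists (A *m (a^-1 *: u^T)); split.
    split=> [|C _]; first exact: rank_leq_col.
    by rewrite subrr frob0 frob_ge0.
  rewrite /line_proj VT -mulmxA; congr (A *m _).
  by rewrite -scalemxAr -scalemxAl scalerA -a2 invfM.
case=> [[/eqP]|[_ [r [U [s [V [[uE UU VV s0] [B [[_ Bbest] ->]]]]]]]]].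
  by rewrite (negPf u0).
have r1 : (r <= 1)%N.
  rewrite -(@mxrank1 R r) -UU; apply: leq_trans (mxrankM_maxl _ _) _.
  exact: rank_leq_col.
case: r r1 U s V uE UU VV s0 B Bbest => [|[|//]] _ U s V uE UU VV s0 B Bbest.
  by case/eqP: u0; rewrite uE (thinmx0 U) !mul0mx.
(* [A V] has one column, hence rank at most [1], and is its own best approximation. *)
have -> : B = A *m V.
  apply/eqP; rewrite eq_sym -subr_eq0; apply/eqP/frob_eq0/le_anti.
  rewrite frob_ge0 andbT; apply: le_trans (Bbest (A *m V) _) _.
    exact: rank_leq_col.
  by rewrite subrr frob0.
rewrite -mulmxA; congr (A *m _).
pose x := U 0 0 * s 0 0.
have uV : u = x *: V^T.
  rewrite uE [U]mx11_scalar [diag_mx s]mx11_scalar mxE eqxx mulr1n.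
  by rewrite -scalar_mxM mul_scalar_mx.
have x0 : x != 0.
  by apply: contraNneq u0 => x0; rewrite uV x0 scale0r.
have uVT : u^T = x *: V by rewrite uV linearZ /= trmxK.
rewrite /line_proj uVT uV -!scalemxAl -!scalemxAr VV !scalerA !mxE eqxx mulr1.
by rewrite -mulrA mulVf ?scale1r // mulf_neq0.
Qed.

Lemma SCW_loss_row0 n d (w : 'cV[R]_n) (A : 'M[R]_(n, d)) :
  w^T *m A = 0 -> SCW_loss 1 w^T A = frob A.
Proof.
move=> u0; rewrite /SCW_loss; case: xgetP => [l _ [M [[[_ ->]|[/eqP//]]] ->]|no].
  by rewrite subr0.
by case: (no (frob A)); exists 0; split; [left | rewrite subr0].
Qed.

(** Uniqueness of the output in [is_SCW_row] forces the value chosen by [xget]. *)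
Lemma SCW_loss_row n d (w : 'cV[R]_n) (A : 'M[R]_(n, d)) :
  w^T *m A != 0 -> SCW_loss 1 w^T A = frob (A - A *m line_proj (w^T *m A)).
Proof.
move=> u0; rewrite /SCW_loss; case: xgetP => [l _ [M [/(is_SCW_row _ u0) -> ->]] //|no].
case: (no (frob (A - A *m line_proj (w^T *m A)))).
by exists (A *m line_proj (w^T *m A)); split=> //; apply/is_SCW_row.
Qed.

(** This is [|A^T w|^2], and [gram2_form] is [|A A^T w|^2]; both are quadratic forms in [w] with
    symmetric matrices. *)
Definition gram_form n d (w : 'cV[R]_n) (A : 'M[R]_(n, d)) : R :=
  (w^T *m (A *m A^T) *m w) 0 0.

Definition gram2_form n d (w : 'cV[R]_n) (A : 'M[R]_(n, d)) : R :=
  (w^T *m ((A *m A^T) *m (A *m A^T)) *m w) 0 0.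

Lemma gram_formE n d (w : 'cV[R]_n) (A : 'M[R]_(n, d)) :
  gram_form w A = ((w^T *m A) *m (w^T *m A)^T) 0 0.
Proof. by rewrite /gram_form trmx_mul trmxK !mulmxA. Qed.

(** Pythagoras: [P = line_proj u] is symmetric and idempotent, so the squared loss is
    [|A|^2 - tr (A P A^T)], and the trace is [|A u^T|^2 / |u|^2] with [u = w^T A]. *)
Lemma SCW_loss_sqr n d (w : 'cV[R]_n) (A : 'M[R]_(n, d)) :
  w^T *m A != 0 -> frob A = 1 ->
  SCW_loss 1 w^T A ^+ 2 = 1 - gram2_form w A / gram_form w A.
Proof.
move=> u0 A1; rewrite SCW_loss_row // frob_sqr gram_formE.
have -> : gram2_form w A = \tr (A *m (w^T *m A)^T *m (A *m (w^T *m A)^T)^T).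
  rewrite mxtrace_mulC /mxtrace big_ord1 /gram2_form; congr (_ 0 0).
  by rewrite !trmx_mul !trmxK !mulmxA.
have := row_sqr_gt0 u0; rewrite /line_proj.
move: (w^T *m A) => u; set nu := (u *m u^T) 0 0 => nu0.
set P := _ *: _; have PT : P^T = P by rewrite /P linearZ /= trmx_mul trmxK.
have PP : P *m P = P.
  rewrite /P -scalemxAl -scalemxAr scalerA -mulmxA [u *m _]mulmxA.
  rewrite [u *m u^T]mx11_scalar -/nu mul_scalar_mx -scalemxAr scalerA.
  by rewrite -mulrA mulVf ?mulr1 // gt_eqF.
have -> : (A - A *m P) *m (A - A *m P)^T = A *m A^T - A *m P *m A^T.
  rewrite linearB /= trmx_mul PT mulmxBl !mulmxBr !mulmxA.
  by rewrite -[A *m P *m P]mulmxA PP subrr subr0.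
rewrite raddfB /= -(frob_sqr A) A1 expr1n; congr (_ - _).
by rewrite /P -scalemxAr -scalemxAl mxtraceZ mulrC trmx_mul trmxK !mulmxA.
Qed.

Lemma SCW_loss_bounds n d (w : 'cV[R]_n) (A : 'M[R]_(n, d)) :
  frob A = 1 -> 0 <= SCW_loss 1 w^T A <= 1.
Proof.
move=> A1; have [u0|u0] := eqVneq (w^T *m A) 0.
  by rewrite SCW_loss_row0 // A1 ler01 lexx.
have l0 : 0 <= SCW_loss 1 w^T A by rewrite SCW_loss_row // frob_ge0.
rewrite l0 /= -(@ler_pXn2r _ 2) ?nnegrE // expr1n SCW_loss_sqr // gerBl.
rewrite divr_ge0 //; last by rewrite gram_formE ltW // row_sqr_gt0.
have -> : gram2_form w A = (w^T *m A *m A^T *m (w^T *m A *m A^T)^T) 0 0.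
  by rewrite /gram2_form !trmx_mul !trmxK !mulmxA.
move: (_ *m A^T) => v; rewrite mxE sumr_ge0 // => k _.
by rewrite [_^T k 0]mxE -expr2 sqr_ge0.
Qed.

(* Perturbing the quadratic form by [t ^+ 2 - t |A^T w|^2] removes the equality
   cases, including the exceptional locus [A^T w = 0] where the loss is [1]. *)
Lemma loss_gt_quad n d (w : 'cV[R]_n) (A : 'M[R]_(n, d)) (r : R) :
  frob A = 1 -> 0 <= r < 1 ->
  exists2 e, 0 < e & forall t, `|t| < e -> 0 < t ->
    let f := (1 - r ^+ 2 - t) * gram_form w A - gram2_form w A + t ^+ 2 in
    if r < SCW_loss 1 w^T A then 0 < f else f < 0.
Proof.
move=> A1 /andP [r0 r1]; have [u0|u0] := eqVneq (w^T *m A) 0.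
  (* Both forms vanish here, so only [t ^ 2 > 0] remains, in agreement with the loss [1 > r]. *)
  exists 1 => // t _ t0 /=; rewrite SCW_loss_row0 // A1 r1.
  have -> : gram_form w A = 0 by rewrite gram_formE u0 mul0mx mxE.
  have -> : gram2_form w A = 0 by rewrite /gram2_form !mulmxA u0 !mul0mx mxE.
  by rewrite mulr0 subr0 add0r exprn_gt0.
have q0 : 0 < gram_form w A by rewrite gram_formE row_sqr_gt0.
have -> : (r < SCW_loss 1 w^T A) =
    (0 < (1 - r ^+ 2) * gram_form w A - gram2_form w A).
  have /andP [l0 _] := SCW_loss_bounds w A1.
  rewrite -(@ltr_pXn2r _ 2) ?nnegrE // SCW_loss_sqr // ltrBrDr -ltrBrDl.
  by rewrite ltr_pdivrMr // subr_gt0.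
move: q0; move: (gram_form w A) (gram2_form w A) => q p q0.
(* With [k = (1 - r ^ 2) q - p], the perturbed form is [k - t q + t ^ 2]: positive for [t < k / q]
   if [k > 0], negative for [0 < t < q] if [k <= 0]. *)
case: ltrP => [kappa|kappa].
  exists (((1 - r ^+ 2) * q - p) / q) => [|t]; first exact: divr_gt0.
  by rewrite ltr_pdivlMr // => te t0 /=; rewrite gtr0_norm // in te; nra.
by exists q => // t; move=> te t0 /=; rewrite gtr0_norm // in te; nra.
Qed.
End SCWLoss.

(** * Shattering by the loss class: upper and lower bounds *)

Lemma fat_shatters_pseudo (R : realType) (X : Type) (D : set X)
    (F : set (X -> R)) (eps : R) (N : nat) (x : 'I_N -> X) : 0 < eps ->
  fat_shatters D F eps x -> pseudo_shatters D F x.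
Proof.
move=> e0 [xinj [xD [r rP]]]; split=> //; split=> //; exists r => I.
have [f Ff fP] := rP I; exists f => // i; have [fin fnotin] := fP i.
have [iI|iI] := boolP (i \in I).
  by apply: lt_trans (fin iI); rewrite ltrDl.
apply/negbTE; rewrite -leNgt ltW //; apply: lt_trans (fnotin iI) _.
by rewrite gtrBl.
Qed.

(** The forms fed to [sign_patterns_bound] have matrix [(1 - r ^ 2 - t) B - B ^ 2], where
    [B = A A^T], and constant term [t ^ 2]. *)
Lemma pseudo_shatters_bound (R : realType) (n d N : nat)
    (x : 'I_N -> 'M[R]_(n, d)) : (0 < n)%N ->
  pseudo_shatters (@unit_frob_sphere R n d) (@L1_class R n d) x ->
  (N <= 8 * n)%N.
Proof.
move=> n0 [_ [x1 [r rP]]].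
have {rP} rP (I : {set 'I_N}) : exists w : 'cV[R]_n,
    forall i, (r i < SCW_loss 1 w^T (x i)) = (i \in I).
  by have [f [w ->] fP] := rP I; exists w.
(* The empty pattern puts a loss at or below [r i], the full pattern puts one above it, and losses
   lie in [[0, 1]]. *)
have r01 i : 0 <= r i < 1.
  have [w /(_ i)] := rP finset.set0; rewrite finset.inE => /negbT; rewrite -leNgt.
  have /andP [l0 _] := SCW_loss_bounds w (x1 i) => /(le_trans l0) -> /=.
  have [v /(_ i)] := rP (~: finset.set0); rewrite !finset.inE => /lt_le_trans; apply.
  by have /andP [] := SCW_loss_bounds v (x1 i).
have /choice [w wP] := rP.
(* One [t] must serve all witnesses and all matrices, that is, finitely many pairs. *)
have [e e0 eP] := uniform_radius
  (fun p : {set 'I_N} * 'I_N => loss_gt_quad (w p.1) (x1 p.2) (r01 p.2)).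
pose t := e / 2; have t0 : 0 < t by rewrite divr_gt0.
have {}eP := eP t; rewrite gtr0_norm // in eP.
have te : t < e by rewrite /t; lra.
pose B i := x i *m (x i)^T.
have BT i : (B i)^T = B i by rewrite /B trmx_mul trmxK.
apply: (@sign_patterns_bound R n N (fun i => (1 - r i ^+ 2 - t) *: B i - B i *m B i)
  (fun=> t ^+ 2)) => // [i|I].
  by rewrite linearB linearZ /= BT [(B i *m B i)^T]trmx_mul BT.
exists (w I)^T => i; have := eP te (I, i) t0; rewrite /= wP.
have -> : quad ((1 - r i ^+ 2 - t) *: B i - B i *m B i) (t ^+ 2) (w I)^T =
    (1 - r i ^+ 2 - t) * gram_form (w I) (x i) - gram2_form (w I) (x i) + t ^+ 2.
  rewrite /quad /gram_form /gram2_form trmxK -/(B i) mulmxBr mulmxBl.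
  rewrite -scalemxAr -scalemxAl; congr (_ + _).
  by rewrite [LHS]mxE [X in X + _]mxE [X in _ + X]mxE.
by case: (i \in I).
Qed.

Lemma fat_shatters_basis (R : realType) (n d : nat) (j : 'I_d) (eps : R) :
  0 < eps -> eps < 1 / 2 ->
  fat_shatters (@unit_frob_sphere R n d) (@L1_class R n d) eps
    (fun i : 'I_n => delta_mx i j).
Proof.
move=> e0 e2.
have xj1 i : frob (delta_mx i j : 'M[R]_(n, d)) = 1.
  apply/eqP; rewrite -(@eqrXn2 _ 2) ?frob_ge0 //.
  rewrite frob_sqr trmx_delta mul_delta_mx expr1n /mxtrace (bigD1 i) //= mxE eqxx.
  by rewrite big1 ?addr0 // => k /negPf ki; rewrite mxE ki.
split=> [i i' /matrixP/(_ i j)|].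
  rewrite !mxE !eqxx andbT; case: eqP => // _ /eqP.
  by rewrite oner_eq0.
(* Halfway between the losses [0] and [1], which leaves any margin below [1 / 2]. *)
split=> //; exists (fun=> 1 / 2) => I.
pose w : 'cV[R]_n := \col_i (i \notin I)%:R.
exists (SCW_loss 1 w^T) => [|i]; first by exists w.
have uE : w^T *m (delta_mx i j : 'M[R]_(n, d)) = (i \notin I)%:R *: delta_mx 0 j.
  apply/matrixP => a b; rewrite ord1 !mxE (bigD1 i) //= big1 => [|k ki].
    by rewrite !mxE !eqxx addr0.
  by rewrite !mxE (negPf ki) mulr0.
have d0 : delta_mx 0 j != 0 :> 'rV[R]_d.
  by apply/eqP => /matrixP/(_ 0 j)/eqP; rewrite !mxE !eqxx oner_eq0.
split=> iI.
  rewrite SCW_loss_row0 ?xj1; first lra.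
  by rewrite uE iI scale0r.
suff -> : SCW_loss 1 w^T (delta_mx i j) = 0 by lra.
rewrite SCW_loss_row uE iI scale1r // /line_proj trmx_delta !mul_delta_mx.
by rewrite -scalemxAr mul_delta_mx mxE !eqxx invr1 scale1r subrr frob0.
Qed.

(* pdim(L_1) = Theta(n) and fatdim_eps(L_1) = Theta(n) for every eps in (0,1/2),
   with absolute constants c1, c2 (independent of n, d, eps):
   the maximum size of a (pseudo/fat) shattered subset of the domain
   lies in [c1 n, c2 n]. *)
Theorem theorem4p2 (R : realType) :
  exists c1 c2 : R, 0 < c1 /\ 0 < c2 /\
  forall n d : nat, (1 <= d)%N -> (d <= n)%N ->
    ((exists (N : nat) (x : 'I_N -> 'M[R]_(n, d)),
        c1 * n%:R <= N%:R /\
        pseudo_shatters (@unit_frob_sphere R n d) (@L1_class R n d) x) /\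
     (forall (N : nat) (x : 'I_N -> 'M[R]_(n, d)),
        pseudo_shatters (@unit_frob_sphere R n d) (@L1_class R n d) x ->
        N%:R <= c2 * n%:R)) /\
    (forall eps : R, 0 < eps -> eps < 1 / 2 ->
     (exists (N : nat) (x : 'I_N -> 'M[R]_(n, d)),
        c1 * n%:R <= N%:R /\
        fat_shatters (@unit_frob_sphere R n d) (@L1_class R n d) eps x) /\
     (forall (N : nat) (x : 'I_N -> 'M[R]_(n, d)),
        fat_shatters (@unit_frob_sphere R n d) (@L1_class R n d) eps x ->
        N%:R <= c2 * n%:R)).
Proof.
exists 1, 8; split; [exact: ltr01 | split; [exact: ltr0n |]].
move=> n d d1 dn; have n0 : (0 < n)%N by apply: leq_trans dn.
have upper N (x : 'I_N -> 'M[R]_(n, d)) :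
    pseudo_shatters (@unit_frob_sphere R n d) (@L1_class R n d) x ->
    N%:R <= 8 * n%:R :> R.
  by move=> /(pseudo_shatters_bound n0); rewrite -natrM ler_nat.
pose x i : 'M[R]_(n, d) := delta_mx i (Ordinal d1).
have lower eps : 0 < eps -> eps < 1 / 2 ->
    fat_shatters (@unit_frob_sphere R n d) (@L1_class R n d) eps x.
  exact: fat_shatters_basis.
split=> [|eps e0 e2].
  split=> //; exists n, x; split; first by rewrite mul1r.
  (* Any margin in [(0, 1/2)] would serve; [1 / 4] is an arbitrary choice. *)
  by apply: (@fat_shatters_pseudo _ _ _ _ (1 / 4)); [|apply: lower]; lra.
split=> [|N y /(fat_shatters_pseudo e0)]; last exact: upper.
by exists n, x; split; [rewrite mul1r | exact: lower].
Qed.
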